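(* Let $a,b\in I$ with $a<s_0<b$. Let $f:[a,b]\to\mathbb{R}$ be an absolutely $\beta$-integrable function on $[a,b]$, and suppose that there exist real numbers $m$ and $M$ such that $m\le f(x)\le M$ for all $x\in[a,b]_\beta$. If $u:[a,b]\to\mathbb{R}$ is such that $D_\beta u$ is bounded on $[a,b]_\beta$ and $u(s_0^+)=u(s_0^-)$, then $$\left|\int_a^b f(x)\,d_\beta u(x)-\frac{u(b)-u(a)}{b-a}\int_a^b f(t)\,d_\beta t\right|\le\frac12\|D_\beta u\|_\infty(M-m)(b-a),$$ where $\|D_\beta u\|_\infty:=\sup_{t\in[a,b]_\beta}|(D_\beta u)(t)|$. The constant $\frac12$ is the best possible: there is no constant $c<\frac12$ such that the inequality with $\frac12$ replaced by $c$ holds for all admissible data $(I,\beta,a,b,f,u,m,M)$.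
   Context: Setting: $I\subseteq\mathbb{R}$ is an interval and $\beta:I\to I$ is a strictly increasing continuous function with exactly one fixed point $s_0\in I$, satisfying $(t-s_0)(\beta(t)-t)\le 0$ for all $t\in I$, with equality only if $t=s_0$. Write $\beta^0(t)=t$ and $\beta^k$ for the $k$-fold composition of $\beta$ with itself. For $a,b\in I$, $[a,b]_\beta:=\{\beta^k(a):k\ge 0\}\cup\{\beta^k(b):k\ge 0\}\cup\{s_0\}$. The $\beta$-integral is $\int_a^b h\,d_\beta:=\int_{s_0}^b h\,d_\beta-\int_{s_0}^a h\,d_\beta$, where $\int_{s_0}^x h\,d_\beta:=\sum_{k=0}^{\infty}\big(\beta^k(x)-\beta^{k+1}(x)\big)h\big(\beta^k(x)\big)$; also written $\int_a^b h(x)\,d_\beta x$. The function $h$ is $\beta$-integrable on $[a,b]$ if these series converge for $x=a$ and $x=b$, and absolutely $\beta$-integrable on $[a,b]$ if $|h|$ is $\beta$-integrable on $[a,b]$. The $\beta$-derivative is $(D_\beta u)(t):=\frac{u(\beta(t))-u(t)}{\beta(t)-t}$ for $t\ne s_0$, and $(D_\beta u)(s_0):=u'(s_0)$ if this derivative exists. Here $u$ need not be differentiable, or even continuous, at $s_0$: boundedness of $D_\beta u$ on $[a,b]_\beta$ and the supremum $\|D_\beta u\|_\infty$ refer to the points $t\in[a,b]_\beta$ with $t\neq s_0$ (when $u'(s_0)$ exists, including $t=s_0$ does not change the supremum). Riemann–Stieltjes $\beta$-integral: for a real function $u$ of bounded variation on $[a,b]_\beta$ (automatic when $D_\beta u$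 is bounded), $$\int_a^b f(x)\,d_\beta u(x):=\sum_{k=0}^\infty f(\beta^k(b))\big(u(\beta^k(b))-u(\beta^{k+1}(b))\big)-\sum_{k=0}^\infty f(\beta^k(a))\big(u(\beta^k(a))-u(\beta^{k+1}(a))\big).$$ Notation: $u(s_0^+):=\lim_{n\to\infty}u(\beta^n(b))$ and $u(s_0^-):=\lim_{n\to\infty}u(\beta^n(a))$; the hypothesis $u(s_0^+)=u(s_0^-)$ means that both limits exist and coincide. *)

(* Defs.v *)
From Stdlib Require Import Reals.
From Coquelicot Require Import Coquelicot.
Open Scope R_scope.

(* Functions on an interval are modelled as total functions [R -> R]; every
   hypothesis and every integral below only looks at their values on the
   interval. *)

Definition interval (I : R -> Prop) : Prop :=
  forall x y z : R, I x -> I y -> x <= z <= y -> I z.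

Record beta_setting (I : R -> Prop) (beta : R -> R) (s0 : R) : Prop := {
  bs_interval : interval I;
  bs_maps : forall t, I t -> I (beta t);
  bs_increasing : forall s t, I s -> I t -> s < t -> beta s < beta t;
  bs_continuous : continuous_on I beta;
  bs_s0 : I s0;
  bs_fixed : beta s0 = s0;
  bs_unique : forall t, I t -> beta t = t -> t = s0;
  bs_sign : forall t, I t -> (t - s0) * (beta t - t) <= 0;
  bs_sign_eq : forall t, I t -> (t - s0) * (beta t - t) = 0 -> t = s0
}.

Definition beta_interval (beta : R -> R) (s0 a b : R) (t : R) : Prop :=
  (exists k : nat, t = Nat.iter k beta a) \/
  (exists k : nat, t = Nat.iter k beta b) \/
  t = s0.

Definition beta_term (beta h : R -> R) (x : R) (k : nat) : R :=
  (Nat.iter k beta x - Nat.iter (S k) beta x) * h (Nat.iter k beta x).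

Definition beta_integral (beta h : R -> R) (a b : R) : R :=
  Series (beta_term beta h b) - Series (beta_term beta h a).

Definition beta_integrable (beta h : R -> R) (a b : R) : Prop :=
  ex_series (beta_term beta h a) /\ ex_series (beta_term beta h b).

Definition abs_beta_integrable (beta h : R -> R) (a b : R) : Prop :=
  beta_integrable beta (fun t => Rabs (h t)) a b.

Definition beta_derivative (beta : R -> R) (s0 : R) (u : R -> R) (t : R) : R :=
  if Req_dec_T t s0 then Derive u s0
  else (u (beta t) - u t) / (beta t - t).

(* [u] need not be differentiable at [s0], where [Derive u s0] may be a
   meaningless default value: the point [s0] is left out of the bound and of
   the supremum. *)
Definition beta_derivative_bounded
    (beta : R -> R) (s0 a b : R) (u : R -> R) : Prop :=
  exists K : R, forall t : R, beta_interval beta s0 a b t -> t <> s0 ->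
    Rabs (beta_derivative beta s0 u t) <= K.

Definition beta_derivative_norm
    (beta : R -> R) (s0 a b : R) (u : R -> R) : R :=
  real (Lub_Rbar (fun y => exists t : R,
    beta_interval beta s0 a b t /\ t <> s0 /\
    y = Rabs (beta_derivative beta s0 u t))).

Definition RS_term (beta f u : R -> R) (x : R) (k : nat) : R :=
  f (Nat.iter k beta x) * (u (Nat.iter k beta x) - u (Nat.iter (S k) beta x)).

(* [Series] is the sum only for convergent series; here convergence follows
   from [f] and the beta-derivative of [u] being bounded. *)
Definition RS_beta_integral (beta f u : R -> R) (a b : R) : R :=
  Series (RS_term beta f u b) - Series (RS_term beta f u a).

(* u(s0+) = u(s0-) *)
Definition equal_side_limits (beta u : R -> R) (a b : R) : Prop :=
  exists l : R,
    is_lim_seq (fun n => u (Nat.iter n beta b)) (Finite l) /\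
    is_lim_seq (fun n => u (Nat.iter n beta a)) (Finite l).

Record admissible (I : R -> Prop) (beta : R -> R) (s0 a b : R)
    (f u : R -> R) (m M : R) : Prop := {
  adm_setting : beta_setting I beta s0;
  adm_a : I a;
  adm_b : I b;
  adm_order : a < s0 < b;
  adm_f_integrable : abs_beta_integrable beta f a b;
  adm_f_bounds : forall x, beta_interval beta s0 a b x -> m <= f x <= M;
  adm_u_bounded : beta_derivative_bounded beta s0 a b u;
  adm_u_limits : equal_side_limits beta u a b
}.

(* Main.v *)
(* On [a,b] the beta-integral is integration against a positive atomic measure
   of mass b - a, the atoms being the points beta^k(a), beta^k(b); the
   Riemann-Stieltjes integral has density D_beta u against it, and u(b) - u(a)
   is the total integral of D_beta u because the one-sided limits of u agree.
   With F the mean of f, the quantity to bound is the integral of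
   D_beta u * (f - F), at most ||D_beta u|| times the integral of |f - F|.  By
   convexity, |f - F| lies below the chord
   ((M - f)(F - m) + (f - m)(M - F)) / (M - m), whose mean
   2 (M - F)(F - m) / (M - m) is at most (M - m) / 2.  Equality occurs for
   u = |x| and f = sign x on [-1, 1]. *)
Require Import Defs.
From Stdlib Require Import Reals Lra.
From Coquelicot Require Import Coquelicot.
Open Scope R_scope.

(** * Series of real numbers: comparison, linear combinations, telescoping *)

(* [is_series_ext] at type [R], so that [ring] recognises the side goal. *)
Lemma is_series_eq (A B : nat -> R) (X : R) :
  (forall k, A k = B k) -> is_series A X -> is_series B X.
Proof. exact (is_series_ext A B X). Qed.

Lemma is_series_Rabs_le (A B : nat -> R) (X Y : R) :
  is_series A X -> is_series B Y -> (forall k, Rabs (A k) <= B k) -> Rabs X <= Y.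
Proof.
  intros HA HB Hle.
  assert (HaA : ex_series (fun k => Rabs (A k))).
  { apply (ex_series_le (fun k => Rabs (A k)) B).
    - intros k. change (Rabs (Rabs (A k)) <= B k). rewrite Rabs_Rabsolu. apply Hle.
    - exists Y; exact HB. }
  rewrite <- (is_series_unique _ _ HA), <- (is_series_unique _ _ HB).
  apply Rle_trans with (1 := Series_Rabs _ HaA).
  apply Series_le.
  - intros k; split; [apply Rabs_pos | apply Hle].
  - exists Y; exact HB.
Qed.

Lemma is_series_nonneg (B : nat -> R) (Y : R) :
  is_series B Y -> (forall k, 0 <= B k) -> 0 <= Y.
Proof.
  intros HB H0. apply Rle_trans with (1 := Rabs_pos Y).
  apply (is_series_Rabs_le B B); auto.
  intros k. rewrite Rabs_pos_eq; auto using Rle_refl.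
Qed.

Lemma ex_series_mult_bounded (p v : nat -> R) (C : R) :
  ex_series p -> (forall k, 0 <= p k) -> (forall k, Rabs (v k) <= C) ->
  ex_series (fun k => p k * v k).
Proof.
  intros Hp Hp0 Hv.
  apply (ex_series_le (fun k => p k * v k) (fun k => C * p k)).
  - intros k. change (Rabs (p k * v k) <= C * p k).
    rewrite Rabs_mult, (Rabs_pos_eq (p k)) by apply Hp0.
    rewrite Rmult_comm. apply Rmult_le_compat_r; [apply Hp0 | apply Hv].
  - apply (ex_series_scal_l C p Hp).
Qed.

Lemma is_series_lincomb (A B : nat -> R) (X Y r s : R) :
  is_series A X -> is_series B Y ->
  is_series (fun k => r * A k + s * B k) (r * X + s * Y).
Proof.
  intros HA HB.
  apply (is_series_plus (fun k => r * A k) (fun k => s * B k)).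
  - exact (is_series_scal_l r A X HA).
  - exact (is_series_scal_l s B Y HB).
Qed.

Lemma is_series_telescope (v : nat -> R) (l : R) :
  is_lim_seq v l -> is_series (fun k => v k - v (S k)) (v O - l).
Proof.
  intros Hv.
  assert (Hsum : forall n, sum_n (fun k => v k - v (S k)) n = v O - v (S n)).
  { induction n as [|n IH].
    - now rewrite sum_O.
    - rewrite sum_Sn, IH. change plus with Rplus. simpl. ring. }
  change (is_lim_seq (sum_n (fun k => v k - v (S k))) (v O - l)).
  apply is_lim_seq_ext with (fun n => v O - v (S n)).
  - intros n; symmetry; apply Hsum.
  - apply is_lim_seq_minus'; [apply is_lim_seq_const |].
    now apply (is_lim_seq_incr_1 v).
Qed.

(** * The Grüss inequality for two discrete measures *)

(** The right side minus the left is [2 * (M - g) * (F - m)] when [g >= F] and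
    [2 * (g - m) * (M - F)] when [g < F]. Multiplying by [M - m] keeps the case [m = M] free of
    division. *)
Lemma chord_bound (m M F g : R) :
  m <= g <= M -> m <= F <= M ->
  (M - m) * Rabs (g - F) <= (M - g) * (F - m) + (g - m) * (M - F).
Proof.
  intros Hg HF. unfold Rabs; destruct (Rcase_abs (g - F)); nra.
Qed.

(* The weights [p], [q] sit on the two orbits; the conclusion is a Grüss
   inequality for the sum of the two discrete measures. *)
Lemma weighted_gruss (p q g h d e : nat -> R) (m M D P Q G H U V X Y : R) :
  (forall k, 0 <= p k) -> (forall k, 0 <= q k) ->
  (forall k, m <= g k <= M) -> (forall k, m <= h k <= M) ->
  (forall k, Rabs (d k) <= D) -> (forall k, Rabs (e k) <= D) ->
  is_series p P -> is_series q Q ->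
  is_series (fun k => p k * g k) G -> is_series (fun k => q k * h k) H ->
  is_series (fun k => p k * d k) U -> is_series (fun k => q k * e k) V ->
  is_series (fun k => p k * (g k * d k)) X ->
  is_series (fun k => q k * (h k * e k)) Y ->
  0 < P + Q ->
  Rabs (X + Y - (U + V) / (P + Q) * (G + H)) <= 1 / 2 * D * (M - m) * (P + Q).
Proof.
  intros Hp Hq Hg Hh Hd He SP SQ SG SH SU SV SX SY HPQ.
  set (F := (G + H) / (P + Q)).
  assert (EF : G + H = F * (P + Q)) by (unfold F; field; lra).
  assert (HD : 0 <= D) by (generalize (Hd O), (Rabs_pos (d O)); lra).
  (* The k-th atoms of the two orbits are paired, which turns each integral over both orbits into a
     single series. *)
  assert (SPQ := is_series_lincomb p q P Q 1 1 SP SQ).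
  assert (SGH := is_series_lincomb _ _ G H 1 1 SG SH).
  assert (SUV := is_series_lincomb _ _ U V 1 1 SU SV).
  assert (SXY := is_series_lincomb _ _ X Y 1 1 SX SY).
  (* The integrals of [f - m] and [M - f] are nonnegative; dividing by the total mass places the
     mean between the bounds. *)
  assert (HF : m <= F <= M).
  { assert (Hlo : 0 <= 1 * (1 * G + 1 * H) + (- m) * (1 * P + 1 * Q)).
    { apply (is_series_nonneg _ _ (is_series_lincomb _ _ _ _ 1 (- m) SGH SPQ)).
      intros k. generalize (Hp k), (Hq k), (Hg k), (Hh k); intros; nra. }
    assert (Hhi : 0 <= (-1) * (1 * G + 1 * H) + M * (1 * P + 1 * Q)).
    { apply (is_series_nonneg _ _ (is_series_lincomb _ _ _ _ (-1) M SGH SPQ)).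
      intros k. generalize (Hp k), (Hq k), (Hg k), (Hh k); intros; nra. }
    split; nra. }
  (* The subtracted product is [F * (U + V)], so the quantity is the integral of the density times
     [f - F]. *)
  replace (X + Y - (U + V) / (P + Q) * (G + H))
    with (1 * (1 * X + 1 * Y) + (- F) * (1 * U + 1 * V))
    by (unfold F; field; lra).
  assert (SL := is_series_lincomb _ _ _ _ 1 (- F) SXY SUV).
  assert (Hpt : forall k,
    Rabs (1 * (1 * (p k * (g k * d k)) + 1 * (q k * (h k * e k)))
          + (- F) * (1 * (p k * d k) + 1 * (q k * e k)))
    <= D * (p k * Rabs (g k - F) + q k * Rabs (h k - F))).
  { intros k.
    replace (1 * (1 * (p k * (g k * d k)) + 1 * (q k * (h k * e k)))
             + (- F) * (1 * (p k * d k) + 1 * (q k * e k)))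
      with (d k * (p k * (g k - F)) + e k * (q k * (h k - F))) by ring.
    apply Rle_trans with (1 := Rabs_triang _ _).
    rewrite !Rabs_mult, (Rabs_pos_eq (p k)), (Rabs_pos_eq (q k)) by auto.
    rewrite Rmult_plus_distr_l.
    apply Rplus_le_compat; apply Rmult_le_compat_r; auto;
      apply Rmult_le_pos; auto using Rabs_pos. }
  (* For [M = m] the chord is undefined, but every value equals [F] and both sides vanish. *)
  destruct (Req_dec M m) as [EM | NM].
  - assert (HX : Rabs (1 * (1 * X + 1 * Y) + (- F) * (1 * U + 1 * V)) <= 0 * P + 0 * Q).
    { apply (is_series_Rabs_le _ (fun k => 0 * p k + 0 * q k) _ _ SL).
      - now apply is_series_lincomb.
      - intros k. apply Rle_trans with (1 := Hpt k).
        replace (g k - F) with 0 by (generalize (Hg k); lra).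
        replace (h k - F) with 0 by (generalize (Hh k); lra).
        rewrite Rabs_R0. lra. }
    rewrite EM. lra.
  - assert (HmM : 0 < M - m) by lra.
    (* Slope and intercept of [D] times the chord as a function of the value of [f]: its integral is
       then a combination of [G + H] and [P + Q]. *)
    pose (al := D * (M + m - 2 * F) / (M - m)).
    pose (be := D * (M * (F - m) - m * (M - F)) / (M - m)).
    assert (HX : Rabs (1 * (1 * X + 1 * Y) + (- F) * (1 * U + 1 * V))
                 <= al * (1 * G + 1 * H) + be * (1 * P + 1 * Q)).
    { apply (is_series_Rabs_le _
        (fun k => al * (1 * (p k * g k) + 1 * (q k * h k)) + be * (1 * p k + 1 * q k))
        _ _ SL).
      - now apply is_series_lincomb.
      - intros k. apply Rle_trans with (1 := Hpt k).
        assert (C : forall y, m <= y <= M -> Rabs (y - F)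
            <= ((M - y) * (F - m) + (y - m) * (M - F)) / (M - m)).
        { intros y Hy. apply Rmult_le_reg_l with (1 := HmM).
          replace ((M - m) * (((M - y) * (F - m) + (y - m) * (M - F)) / (M - m)))
            with ((M - y) * (F - m) + (y - m) * (M - F)) by (field; lra).
          now apply chord_bound. }
        replace (al * (1 * (p k * g k) + 1 * (q k * h k)) + be * (1 * p k + 1 * q k))
          with (D * (p k * (((M - g k) * (F - m) + (g k - m) * (M - F)) / (M - m))
                   + q k * (((M - h k) * (F - m) + (h k - m) * (M - F)) / (M - m))))
          by (unfold al, be; field; lra).
        apply Rmult_le_compat_l; [exact HD |].
        apply Rplus_le_compat; apply Rmult_le_compat_l; auto. }
    apply Rle_trans with (1 := HX).
    replace (al * (1 * G + 1 * H) + be * (1 * P + 1 * Q))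
      with (D * (P + Q) * (2 * (M - F) * (F - m) / (M - m))).
    + replace (1 / 2 * D * (M - m) * (P + Q)) with (D * (P + Q) * ((M - m) / 2)) by field.
      apply Rmult_le_compat_l; [nra |].
      apply Rmult_le_reg_l with (1 := HmM).
      replace ((M - m) * (2 * (M - F) * (F - m) / (M - m)))
        with (2 * (M - F) * (F - m)) by (field; lra).
      (* [4 * (M - F) * (F - m)] equals [(M - m)^2 - (M + m - 2 * F)^2]. *)
      generalize (pow2_ge_0 (M + m - 2 * F)). nra.
    + replace (1 * G + 1 * H) with (F * (P + Q)) by lra.
      unfold al, be. field; lra.
Qed.

(** * Orbits of [beta] and their convergence to [s0] *)

Lemma orbit_in (I : R -> Prop) (beta : R -> R) (s0 x : R) :
  beta_setting I beta s0 -> I x -> forall k, I (Nat.iter k beta x).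
Proof.
  intros HS Hx; induction k as [|k IH]; [exact Hx | now apply (bs_maps _ _ _ HS)].
Qed.

(** Strict monotonicity keeps the orbit to the right of the fixed point, and there the sign
    condition forces [beta t < t]: otherwise its product would be both nonnegative and nonpositive,
    giving [t = s0]. *)
Lemma orbit_above (I : R -> Prop) (beta : R -> R) (s0 x : R) :
  beta_setting I beta s0 -> I x -> s0 < x ->
  forall k, s0 < Nat.iter (S k) beta x < Nat.iter k beta x.
Proof.
  intros HS Hx Hsx. assert (Is0 := bs_s0 _ _ _ HS).
  assert (Hpos : forall k, s0 < Nat.iter k beta x).
  { induction k as [|k IH]; [exact Hsx |].
    simpl. rewrite <- (bs_fixed _ _ _ HS) at 1.
    apply (bs_increasing _ _ _ HS); auto.
    now apply (orbit_in I beta s0). }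
  intros k; split; [apply Hpos |].
  set (t := Nat.iter k beta x). change (beta t < t).
  assert (It : I t) by now apply (orbit_in I beta s0).
  assert (Ht : s0 < t) by apply Hpos.
  destruct (Rlt_or_le (beta t) t) as [H | H]; [exact H |].
  exfalso. assert (t = s0); [| lra].
  apply (bs_sign_eq _ _ _ HS t It).
  generalize (bs_sign _ _ _ HS t It). nra.
Qed.

Lemma orbit_below (I : R -> Prop) (beta : R -> R) (s0 x : R) :
  beta_setting I beta s0 -> I x -> x < s0 ->
  forall k, Nat.iter k beta x < Nat.iter (S k) beta x < s0.
Proof.
  intros HS Hx Hsx. assert (Is0 := bs_s0 _ _ _ HS).
  assert (Hneg : forall k, Nat.iter k beta x < s0).
  { induction k as [|k IH]; [exact Hsx |].
    simpl. rewrite <- (bs_fixed _ _ _ HS).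
    apply (bs_increasing _ _ _ HS); auto.
    now apply (orbit_in I beta s0). }
  intros k; split; [| apply Hneg].
  set (t := Nat.iter k beta x). change (t < beta t).
  assert (It : I t) by now apply (orbit_in I beta s0).
  assert (Ht : t < s0) by apply Hneg.
  destruct (Rlt_or_le t (beta t)) as [H | H]; [exact H |].
  exfalso. assert (t = s0); [| lra].
  apply (bs_sign_eq _ _ _ HS t It).
  generalize (bs_sign _ _ _ HS t It). nra.
Qed.

Lemma orbit_limit_fixed (I : R -> Prop) (beta : R -> R) (s0 x l : R) :
  beta_setting I beta s0 -> I x -> I l ->
  is_lim_seq (fun k => Nat.iter k beta x) l -> l = s0.
Proof.
  intros HS Hx Hl Hlim.
  apply (bs_unique _ _ _ HS l Hl).
  (* Continuity is only relative to [I], which suffices because the orbit stays in [I]. *)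
  assert (Hb : is_lim_seq (fun k => beta (Nat.iter k beta x)) (beta l)).
  { intros P HP.
    assert (HW := bs_continuous _ _ _ HS l Hl P HP).
    generalize (Hlim _ HW). unfold filtermap.
    apply filter_imp. intros k Hk. apply Hk. now apply (orbit_in I beta s0). }
  (* The image sequence is the shifted orbit, so its limit is also [l]. *)
  apply (is_lim_seq_incr_1 (fun k => Nat.iter k beta x)) in Hlim.
  apply is_lim_seq_unique in Hb. apply is_lim_seq_unique in Hlim.
  simpl in Hlim. rewrite Hb in Hlim. now injection Hlim.
Qed.

(** The orbit is monotone between [x] and [s0]. Its limit lies between them too, hence in [I] even
    if [I] is not closed, and so is the fixed point. *)
Lemma orbit_limit (I : R -> Prop) (beta : R -> R) (s0 x : R) :
  beta_setting I beta s0 -> I x ->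
  is_lim_seq (fun k => Nat.iter k beta x) s0.
Proof.
  intros HS Hx. set (v := fun k => Nat.iter k beta x).
  assert (Is0 := bs_s0 _ _ _ HS).
  destruct (Rtotal_order s0 x) as [Hlt | [Heq | Hgt]].
  - assert (Ho := orbit_above I beta s0 x HS Hx Hlt).
    assert (Hlo : forall k, s0 <= v k) by (intros k; generalize (Ho k); unfold v; lra).
    assert (Hhi : forall k, v k <= x).
    { induction k as [|k IH]; [apply Rle_refl |].
      generalize (Ho k). unfold v in *. lra. }
    destruct (ex_finite_lim_seq_decr v s0) as [l Hl]; auto.
    { intros k. generalize (Ho k). unfold v. lra. }
    assert (Il : I l).
    { apply (bs_interval _ _ _ HS s0 x); auto. split.
      - apply (is_lim_seq_le (fun _ => s0) v s0 l); auto using is_lim_seq_const.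
      - apply (is_lim_seq_le v (fun _ => x) l x); auto using is_lim_seq_const. }
    now rewrite <- (orbit_limit_fixed I beta s0 x l).
  - apply is_lim_seq_ext with (fun _ => s0); [| apply is_lim_seq_const].
    intros k. unfold v. rewrite <- Heq.
    induction k as [|k IH]; [reflexivity |].
    simpl. rewrite <- IH. symmetry. apply (bs_fixed _ _ _ HS).
  - assert (Ho := orbit_below I beta s0 x HS Hx Hgt).
    assert (Hhi : forall k, v k <= s0) by (intros k; generalize (Ho k); unfold v; lra).
    assert (Hlo : forall k, x <= v k).
    { induction k as [|k IH]; [apply Rle_refl |].
      generalize (Ho k). unfold v in *. lra. }
    destruct (ex_finite_lim_seq_incr v s0) as [l Hl]; auto.
    { intros k. generalize (Ho k). unfold v. lra. }
    assert (Il : I l).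
    { apply (bs_interval _ _ _ HS x s0); auto. split.
      - apply (is_lim_seq_le (fun _ => x) v x l); auto using is_lim_seq_const.
      - apply (is_lim_seq_le v (fun _ => s0) l s0); auto using is_lim_seq_const. }
    now rewrite <- (orbit_limit_fixed I beta s0 x l).
Qed.

(** * The beta-derivative and its supremum *)

Lemma beta_derivative_le_norm (beta u : R -> R) (s0 a b t : R) :
  beta_derivative_bounded beta s0 a b u ->
  beta_interval beta s0 a b t -> t <> s0 ->
  Rabs (beta_derivative beta s0 u t) <= beta_derivative_norm beta s0 a b u.
Proof.
  intros [K HK] Ht Hts.
  unfold beta_derivative_norm.
  match goal with |- _ <= real (Lub_Rbar ?E) => set (S := E) end.
  assert (HS : S (Rabs (beta_derivative beta s0 u t))) by (exists t; auto).
  destruct (Lub_Rbar_correct S) as [Hub Hleast].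
  (* [real] would send an infinite supremum to 0: the bound [K] excludes plus infinity, and the
     element in [HS] excludes minus infinity. *)
  assert (HKS : is_ub_Rbar S K).
  { intros y [z [Hz [Hzs ->]]]. apply HK; auto. }
  specialize (Hub _ HS). specialize (Hleast _ HKS).
  destruct (Lub_Rbar S); simpl in *; tauto.
Qed.

Lemma beta_derivative_mult (beta u : R -> R) (s0 t : R) :
  t <> s0 -> beta t <> t ->
  u t - u (beta t) = (t - beta t) * beta_derivative beta s0 u t.
Proof.
  intros Ht Hb. unfold beta_derivative.
  destruct (Req_dec_T t s0) as [E | _]; [contradiction |].
  field. lra.
Qed.

(** * The inequality *)

Lemma beta_gruss (I : R -> Prop) (beta : R -> R) (s0 a b : R) (f u : R -> R) (m M : R) :
  admissible I beta s0 a b f u m M ->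
  Rabs (RS_beta_integral beta f u a b
        - (u b - u a) / (b - a) * beta_integral beta f a b)
    <= 1 / 2 * beta_derivative_norm beta s0 a b u * (M - m) * (b - a).
Proof.
  intros [HS Ia Ib [Hab1 Hab2] _ Hf Hu [l [Hlb Hla]]].
  set (x := fun k => Nat.iter k beta b).
  set (y := fun k => Nat.iter k beta a).
  set (D := beta_derivative_norm beta s0 a b u).
  set (p := fun k => x k - x (S k)).
  (* The orbit of [a] increases to [s0], so its differences are negated to give positive weights;
     this absorbs the minus sign in front of the series at [a]. *)
  set (q := fun k => - (y k - y (S k))).
  set (d := fun k => beta_derivative beta s0 u (x k)).
  set (e := fun k => beta_derivative beta s0 u (y k)).
  assert (Ox : forall k, s0 < x (S k) < x k) by exact (orbit_above I beta s0 b HS Ib Hab2).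
  assert (Oy : forall k, y k < y (S k) < s0) by exact (orbit_below I beta s0 a HS Ia Hab1).
  assert (Bx : forall k, beta_interval beta s0 a b (x k))
    by (intros k; right; left; exists k; reflexivity).
  assert (By : forall k, beta_interval beta s0 a b (y k))
    by (intros k; left; exists k; reflexivity).
  assert (Hp : forall k, 0 <= p k) by (intros k; generalize (Ox k); unfold p; lra).
  assert (Hq : forall k, 0 <= q k) by (intros k; generalize (Oy k); unfold q; lra).
  assert (Hd : forall k, Rabs (d k) <= D).
  { intros k. apply beta_derivative_le_norm; auto. generalize (Ox k); lra. }
  assert (He : forall k, Rabs (e k) <= D).
  { intros k. apply beta_derivative_le_norm; auto. generalize (Oy k); lra. }
  assert (Ed : forall k, u (x k) - u (x (S k)) = p k * d k).
  { intros k. apply (beta_derivative_mult beta u s0 (x k)); generalize (Ox k); unfold x; simpl; lra. }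
  assert (Ee : forall k, - (u (y k) - u (y (S k))) = q k * e k).
  { intros k. unfold q. rewrite <- Ropp_mult_distr_l. f_equal.
    apply (beta_derivative_mult beta u s0 (y k)); generalize (Oy k); unfold y; simpl; lra. }
  (* The two masses are [b - s0] and [s0 - a], with sum [b - a]. *)
  assert (SP : is_series p (b - s0))
    by exact (is_series_telescope x s0 (orbit_limit I beta s0 b HS Ib)).
  assert (SQ : is_series q (- (a - s0)))
    by exact (is_series_opp _ _ (is_series_telescope y s0 (orbit_limit I beta s0 a HS Ia))).
  assert (SU : is_series (fun k => p k * d k) (u b - l)).
  { apply is_series_eq with (1 := Ed).
    exact (is_series_telescope (fun k => u (x k)) l Hlb). }
  assert (SV : is_series (fun k => q k * e k) (- (u a - l))).
  { apply is_series_eq with (1 := Ee).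
    exact (is_series_opp _ _ (is_series_telescope (fun k => u (y k)) l Hla)). }
  set (C := Rabs m + Rabs M).
  assert (HC : forall t, beta_interval beta s0 a b t -> Rabs (f t) <= C).
  { intros t Ht. generalize (Hf t Ht). unfold C, Rabs.
    destruct (Rcase_abs (f t)), (Rcase_abs m), (Rcase_abs M); lra. }
  assert (HCD : forall t c, beta_interval beta s0 a b t -> Rabs c <= D ->
                Rabs (f t * c) <= C * D).
  { intros t c Ht Hc. rewrite Rabs_mult.
    apply Rmult_le_compat; auto using Rabs_pos. }
  assert (EP : ex_series p) by (eexists; exact SP).
  assert (EQ : ex_series q) by (eexists; exact SQ).
  destruct (ex_series_mult_bounded p (fun k => f (x k)) C EP Hp) as [G SG]; auto.
  destruct (ex_series_mult_bounded q (fun k => f (y k)) C EQ Hq) as [H SH]; auto.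
  destruct (ex_series_mult_bounded p (fun k => f (x k) * d k) (C * D) EP Hp) as [X SX]; auto.
  destruct (ex_series_mult_bounded q (fun k => f (y k) * e k) (C * D) EQ Hq) as [Y SY]; auto.
  assert (EI : beta_integral beta f a b = G + H).
  { unfold beta_integral.
    replace (Series (beta_term beta f b)) with G
      by (symmetry; apply is_series_unique; exact SG).
    rewrite (is_series_unique (beta_term beta f a) (- H)); [ring |].
    apply is_series_eq with (fun k => - (q k * f (y k))).
    - intros k. unfold q, beta_term, y. ring.
    - exact (is_series_opp _ _ SH). }
  assert (ER : RS_beta_integral beta f u a b = X + Y).
  { unfold RS_beta_integral.
    rewrite (is_series_unique (RS_term beta f u b) X);
      [rewrite (is_series_unique (RS_term beta f u a) (- Y)); [ring |] |].
    - apply is_series_eq with (fun k => - (q k * (f (y k) * e k))).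
      + intros k.
        transitivity (f (y k) * - (q k * e k)); [ring |].
        rewrite <- Ee. unfold RS_term, y. ring.
      + exact (is_series_opp _ _ SY).
    - apply is_series_eq with (2 := SX).
      intros k. transitivity (f (x k) * (p k * d k)); [ring |].
      rewrite <- Ed. reflexivity. }
  rewrite EI, ER.
  (* The common one-sided limit [l] cancels between the two orbits. *)
  replace (u b - u a) with ((u b - l) + - (u a - l)) by ring.
  replace (b - a) with ((b - s0) + - (a - s0)) by ring.
  apply (weighted_gruss p q (fun k => f (x k)) (fun k => f (y k)) d e); auto.
  lra.
Qed.

(** * Sharpness of the constant 1/2 *)

(** The sign function with value 1 at 0, so that its absolute value is 1 everywhere. *)
Definition sign_step (t : R) : R := if Rlt_dec t 0 then -1 else 1.

Lemma halving_setting : beta_setting (fun _ => True) (fun t => t / 2) 0.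
Proof.
  constructor; try easy; try (intros; lra); try (intros; nra).
  intros t _.
  apply (filterlim_filter_le_1 _ (filter_le_within (F := locally t) _)).
  apply (ex_derive_continuous (fun t : R => t / 2) t). auto_derive; trivial.
Qed.

(** Since [t / 2] has the sign of [t], both points lie on the same linear branch of [Rabs], of slope
    1 or -1. *)
Lemma halving_derivative_Rabs (t : R) :
  t <> 0 -> Rabs (beta_derivative (fun t => t / 2) 0 Rabs t) = 1.
Proof.
  intros Ht. unfold beta_derivative.
  destruct (Req_dec_T t 0) as [E | _]; [contradiction |].
  destruct (Rdichotomy t 0 Ht) as [H | H].
  - rewrite (Rabs_left t), (Rabs_left (t / 2)) by lra.
    replace ((- (t / 2) - - t) / (t / 2 - t)) with (-1) by (field; lra).
    rewrite Rabs_left; lra.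
  - rewrite (Rabs_pos_eq t), (Rabs_pos_eq (t / 2)) by lra.
    replace ((t / 2 - t) / (t / 2 - t)) with 1 by (field; lra).
    apply Rabs_R1.
Qed.

Lemma halving_norm_Rabs :
  beta_derivative_norm (fun t => t / 2) 0 (-1) 1 Rabs = 1.
Proof.
  unfold beta_derivative_norm.
  rewrite (is_lub_Rbar_unique _ (Finite 1)); [reflexivity |].
  split.
  - intros y [t [_ [Ht ->]]]. rewrite halving_derivative_Rabs by exact Ht. apply Rle_refl.
  - intros B HB. apply HB. exists 1. split; [| split].
    + right; left. now exists O.
    + lra.
    + symmetry. apply halving_derivative_Rabs. lra.
Qed.

Lemma halving_admissible :
  admissible (fun _ => True) (fun t => t / 2) 0 (-1) 1 sign_step Rabs (-1) 1.
Proof.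
  assert (Hsum : forall x, ex_series (beta_term (fun t => t / 2) (fun t => Rabs (sign_step t)) x)).
  { intros x. exists (x - 0).
    apply is_series_eq with (2 := is_series_telescope _ _ (orbit_limit _ _ _ x halving_setting Logic.I)).
    intros k. unfold beta_term, sign_step.
    destruct (Rlt_dec _ 0).
    - rewrite Rabs_left by lra. simpl. ring.
    - rewrite Rabs_R1. simpl. ring. }
  constructor; auto using halving_setting; try lra.
  - split; apply Hsum.
  - intros x _. unfold sign_step. destruct (Rlt_dec x 0); lra.
  - exists 1. intros t _ Ht. rewrite halving_derivative_Rabs by exact Ht. lra.
  - exists 0. rewrite <- Rabs_R0.
    split; apply (is_lim_seq_abs _ (Finite 0)); now apply (orbit_limit _ _ _ _ halving_setting).
Qed.

(** On each orbit [sign_step] undoes the absolute value, so both series telescope: the total is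
    [1 - (-1)]. *)
Lemma halving_RS_integral :
  RS_beta_integral (fun t => t / 2) sign_step Rabs (-1) 1 = 2.
Proof.
  unfold RS_beta_integral.
  rewrite (is_series_unique (RS_term _ _ _ 1) (1 - 0));
    [rewrite (is_series_unique (RS_term _ _ _ (-1)) (-1 - 0)); [ring |] |].
  - apply is_series_eq with
      (2 := is_series_telescope _ _ (orbit_limit _ _ _ (-1) halving_setting Logic.I)).
    intros k.
    assert (H := orbit_below _ _ _ (-1) halving_setting Logic.I ltac:(lra) k).
    unfold RS_term, sign_step.
    destruct (Rlt_dec _ 0); [| lra].
    rewrite !Rabs_left by lra. simpl. ring.
  - apply is_series_eq with
      (2 := is_series_telescope _ _ (orbit_limit _ _ _ 1 halving_setting Logic.I)).
    intros k.
    assert (H := orbit_above _ _ _ 1 halving_setting Logic.I ltac:(lra) k).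
    unfold RS_term, sign_step.
    destruct (Rlt_dec _ 0); [lra |].
    rewrite !Rabs_pos_eq by lra. simpl. ring.
Qed.

Theorem corollary4p13 :
  (forall (I : R -> Prop) (beta : R -> R) (s0 a b : R) (f u : R -> R) (m M : R),
    admissible I beta s0 a b f u m M ->
    Rabs (RS_beta_integral beta f u a b
          - (u b - u a) / (b - a) * beta_integral beta f a b)
      <= 1 / 2 * beta_derivative_norm beta s0 a b u * (M - m) * (b - a))
  /\
  ~ (exists c : R, c < 1 / 2 /\
      forall (I : R -> Prop) (beta : R -> R) (s0 a b : R) (f u : R -> R) (m M : R),
        admissible I beta s0 a b f u m M ->
        Rabs (RS_beta_integral beta f u a b
              - (u b - u a) / (b - a) * beta_integral beta f a b)
          <= c * beta_derivative_norm beta s0 a b u * (M - m) * (b - a)).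
Proof.
  split; [exact beta_gruss |].
  intros [c [Hc Hall]].
  specialize (Hall _ _ _ _ _ _ _ _ _ halving_admissible).
  rewrite halving_norm_Rabs, halving_RS_integral in Hall.
  (* As [u] takes equal values at -1 and 1, the subtracted product vanishes, leaving
     [2 <= c * 1 * 2 * 2], which contradicts [c < 1 / 2]. *)
  rewrite (Rabs_pos_eq 1), (Rabs_left (-1)) in Hall by lra.
  replace (1 - - -1) with 0 in Hall by ring.
  unfold Rdiv in Hall.
  rewrite !Rmult_0_l, Rminus_0_r, Rabs_pos_eq in Hall by lra.
  lra.
Qed.
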